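(* Let $T\subseteq\Pi_n$ be a symmetric partition lattice of order $k$, and let $\mu_i\in\mathcal{M}(X_i)$, $1\le i\le n$, satisfy $\#\{i:\mu_i(X_i)=0\}\geq k$. Then there exist $M>0$ and a probability measure $P\in\mathcal{M}(\mathbb{X}_n)$ such that $$T[P]=M(-1)^n\,\mu_1\times\mu_2\times\cdots\times\mu_n.$$
   Context: Let $n\ge2$. $\Pi_n$ denotes the set of all partitions of $\{1,\dots,n\}$ into nonempty disjoint blocks, ordered by refinement: $\pi\le\sigma$ iff every block of $\pi$ is contained in a block of $\sigma$. $\hat{\mathbf{0}}_n$ is the partition into singletons and $\hat{\mathbf{1}}_n$ the one-block partition. A subset $T\subseteq\Pi_n$ is called a lower set if it contains $\hat{\mathbf 0}_n$ and $\hat{\mathbf 1}_n$ and, for every $w\in T\setminus\{\hat{\mathbf 1}_n\}$ and $z\in\Pi_n$ with $z\le w$, one has $z\in T$. A symmetric partition lattice is a lower set $T\subseteq\Pi_n$ such that for every $\pi=(F_1,\dots,F_\ell)\in T$ and every bijection $\tau$ of $\{1,\dots,n\}$, $(\tau(F_1),\dots,\tau(F_\ell))\in T$. Its order is $|T|_\infty:=1+\max$ of the largest block size of $\pi$, over all $\pi\in T\setminus\{\hat{\mathbf 1}_n\}$. Such $T$ carries the induced order, and its M\''obius function, denoted here $\mu_T$, is: $\mu_T(x,x)=1$, $\mu_T(x,y)=-\sum_{z\in T,\,x\le z<y}\mu_T(x,z)$ for $x<y$ in $T$, and $\mu_T(x,y)=0$ otherwise. $X_1,\dots,X_n$ are nonempty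 sets, $\mathbb{X}_n=X_1\times\cdots\times X_n$; $\mathcal{M}(\cdot)$ denotes the vector space of discrete signed measures (finite real linear combinations of Dirac measures). For a probability measure $P\in\mathcal{M}(\mathbb{X}_n)$ and nonempty $F\subseteq\{1,\dots,n\}$, $P_F$ is the marginal of $P$ on $\prod_{i\in F}X_i$; for $\pi=(F_1,\dots,F_\ell)\in\Pi_n$, $P_\pi:=P_{F_1}\times\cdots\times P_{F_\ell}$, viewed as a measure on $\mathbb{X}_n$. The interaction is the signed measure $T[P]:=\sum_{\pi\in T}\mu_T(\pi,\hat{\mathbf{1}}_n)P_\pi$. *)

(* Defs.v *)
From mathcomp Require Import all_boot all_order all_algebra all_fingroup.

Set Implicit Arguments.
Unset Strict Implicit.
Unset Printing Implicit Defensive.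

Import Order.TTheory GRing.Theory Num.Theory.

Local Open Scope ring_scope.

(** * Partitions of the n-element set 'I_n *)

Definition Partitions (n : nat) : {set {set {set 'I_n}}} :=
  [set p : {set {set 'I_n}} | partition p [set: 'I_n]%SET]%SET.

Definition refines (n : nat) (p q : {set {set 'I_n}}) : bool :=
  [forall B in p, exists C in q, B \subset C].

Definition srefines (n : nat) (p q : {set {set 'I_n}}) : bool :=
  refines p q && (p != q).

Definition bottom_part (n : nat) : {set {set 'I_n}} :=
  [set [set i]%SET | i in 'I_n]%SET.

Definition top_part (n : nat) : {set {set 'I_n}} := [set [set: 'I_n]]%SET.

Definition lower_set (n : nat) (T : {set {set {set 'I_n}}}) : Prop :=
  [/\ T \subset Partitions n,
      bottom_part n \in T,
      top_part n \in T
    & forall w z : {set {set 'I_n}}, w \in T -> w != top_part n ->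
        z \in Partitions n -> refines z w -> z \in T].

Definition permute_part (n : nat) (tau : 'S_n) (p : {set {set 'I_n}}) :
  {set {set 'I_n}} := [set tau @: B | B : {set 'I_n} in p]%SET.

Definition symmetric_partition_lattice (n : nat)
    (T : {set {set {set 'I_n}}}) : Prop :=
  lower_set T /\
  forall (p : {set {set 'I_n}}) (tau : 'S_n), p \in T -> permute_part tau p \in T.

Definition lattice_order (n : nat) (T : {set {set {set 'I_n}}}) : nat :=
  (\max_(p in T | p != top_part n) \max_(B in p) #|B|).+1.

(** * Moebius function of T *)

(* The first argument is fuel bounding the recursion depth; [#|T|] suffices,
   since intervals shrink strictly: see [mobiusxx], [mobius_lt], [mobius_out]. *)
Fixpoint mobius_rec (n : nat) (T : {set {set {set 'I_n}}}) (m : nat)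
    (x y : {set {set 'I_n}}) : int :=
  if x == y then 1
  else if m is m'.+1 then
    if srefines x y then
      - \sum_(z in T | refines x z && srefines z y) mobius_rec T m' x z
    else 0
  else 0.

Definition mobius (n : nat) (T : {set {set {set 'I_n}}})
    (x y : {set {set 'I_n}}) : int :=
  if (x \in T) && (y \in T) then mobius_rec T #|T| x y else 0.

Lemma refinesP (n : nat) (p q : {set {set 'I_n}}) :
  reflect (forall B, B \in p -> exists2 C, C \in q & B \subset C) (refines p q).
Proof. by apply: (iffP forall_inP) => h B /h /exists_inP. Qed.

Lemma refines_refl (n : nat) (p : {set {set 'I_n}}) : refines p p.
Proof. by apply/refinesP => B Bp; exists B. Qed.

Lemma refines_trans (n : nat) (q p r : {set {set 'I_n}}) :
  refines p q -> refines q r -> refines p r.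
Proof.
move=> /refinesP pq /refinesP qr; apply/refinesP => B /pq.
move=> [C /qr [D Dr CD] BC].
by exists D => //; apply: subset_trans CD.
Qed.

Lemma refines_anti (n : nat) (p q : {set {set 'I_n}}) :
  p \in Partitions n -> q \in Partitions n ->
  refines p q -> refines q p -> p = q.
Proof.
have sub (a b : {set {set 'I_n}}) : a \in Partitions n ->
    refines a b -> refines b a -> {subset a <= b}.
  rewrite inE => /and3P[_ tr a0] /refinesP ab /refinesP ba B Ba.
  have [C Cb BC] := ab _ Ba.
  have [D Da CD] := ba _ Cb.
  have BD : B \subset D by apply: subset_trans CD.
  have [x xB] : exists x, x \in B.
    by apply/set0Pn; apply: contraNneq a0 => <-.
  have eBD : B = D.
    by rewrite -(def_pblock tr Ba xB) (def_pblock tr Da (subsetP BD _ xB)).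
  by have /eqP -> : B == C by rewrite eqEsubset BC eBD.
move=> pP qP pq qp; apply/setP => B; apply/idP/idP; exact: sub.
Qed.

Section MobiusTheory.
Variables (n : nat) (T : {set {set {set 'I_n}}}).
Hypothesis TP : T \subset Partitions n.
Implicit Types x y z : {set {set 'I_n}}.

Let below x y : {set {set {set 'I_n}}} :=
  [set z in T | refines x z && srefines z y]%SET.

Let below_lt x y z : y \in T -> z \in below x y ->
  (#|below x z| < #|below x y|)%N.
Proof.
move=> yT; rewrite inE => /and3P[zT xz /andP[zy nzy]].
apply: proper_card; apply/properP; split.
  apply/subsetP => w; rewrite !inE => /and3P[-> -> /andP[wz nwz]] /=.
  rewrite /srefines (refines_trans wz zy) /=; apply: contraNneq nwz => wy.
  by apply/eqP; apply: refines_anti; rewrite ?(subsetP TP) // wy.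
by exists z; rewrite !inE /srefines ?eqxx ?andbF // zT xz zy.
Qed.

Let mobius_rec_fuel x y m m' : y \in T ->
  (#|below x y| <= m)%N -> (#|below x y| <= m')%N -> x \in T ->
  mobius_rec T m x y = mobius_rec T m' x y.
Proof.
elim: m m' y => [|m IH] [|m'] y yT hm hm' xT //=; case: eqVneq => // nxy;
    case: ifP => // sxy.
- have : x \in below x y.
    rewrite inE xT sxy andbT /=.
    exact: refines_refl.
  by move: hm; rewrite leqn0 cards_eq0 => /eqP ->; rewrite inE.
- have : x \in below x y.
    rewrite inE xT sxy andbT /=.
    exact: refines_refl.
  by move: hm'; rewrite leqn0 cards_eq0 => /eqP ->; rewrite inE.
- congr (- _); apply: eq_bigr => z hz.
  have zb : z \in below x y by rewrite inE.
  have lt := below_lt yT zb; case/andP: hz => zT _.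
  by apply: IH => //; rewrite -ltnS; apply: leq_trans lt _.
Qed.

Lemma mobiusxx x : x \in T -> mobius T x x = 1.
Proof. by move=> xT; rewrite /mobius xT; case: #|T| => [|m] /=; rewrite eqxx. Qed.

Lemma mobius_lt x y : x \in T -> y \in T -> srefines x y ->
  mobius T x y = - \sum_(z in T | refines x z && srefines z y) mobius T x z.
Proof.
move=> xT yT sxy; rewrite {1}/mobius xT yT /=.
have bT z : (#|below x z| <= #|T|)%N.
  by apply/subset_leq_card/subsetP => w; rewrite inE => /andP[].
rewrite (@mobius_rec_fuel x y #|T| #|T|.+1) //; last exact: leqW.
have /andP[_ /negPf /= ->] := sxy; rewrite sxy; congr (- _).
by apply: eq_bigr => z /andP[zT _]; rewrite /mobius xT zT.
Qed.

Lemma mobius_out x y :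
  ~~ [&& x \in T, y \in T & refines x y] -> mobius T x y = 0.
Proof.
rewrite /mobius; case: (x \in T) (y \in T) => [] [] //= nxy.
have /negPf xy : x != y.
  apply: contraNneq nxy => ->.
  exact: refines_refl.
by case: #|T| => [|m] /=; rewrite xy // /srefines (negPf nxy).
Qed.

End MobiusTheory.

(** * Discrete signed measures, as real-valued functions of arbitrary subsets *)

From mathcomp Require Import all_classical all_reals numfun.

Local Open Scope classical_set_scope.

(* [A |-> \1_A x] is the Dirac measure at x *)
Definition discrete_measure (R : realType) (Y : Type) (m : set Y -> R) : Prop :=
  exists s : seq (R * Y), forall A : set Y, m A = \sum_(c <- s) c.1 * \1_A c.2.

Definition discrete_probability (R : realType) (Y : Type) (P : set Y -> R) : Prop :=
  [/\ discrete_measure P, forall A : set Y, 0 <= P A & P setT = 1].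

(* The sum runs over the points of A where the product is nonzero; there are
   finitely many of them when every [m i] is discrete. *)
Definition product_measure (R : realType) (I : finType) (Y : I -> choiceType)
    (m : forall i : I, set (Y i) -> R) (A : set (forall i : I, Y i)) : R :=
  \sum_(x \in A) \prod_(i : I) m i [set x i].

Section ProductMeasureTheory.
Variables (R : realType) (I : finType) (Y : I -> choiceType).
Variables (y0 : forall i, Y i) (m : forall i : I, set (Y i) -> R).
Arguments m : clear implicits.
Hypothesis mD : forall i, discrete_measure (m i).

Let prod_indic (y : forall i, Y i) (A : forall i, set (Y i)) :
  \prod_i (\1_(A i) (y i) : R) = \1_[set x | forall i, A i (x i)] y.
Proof.
rewrite indicE; case: (boolP (y \in _)) => [/set_mem /= h|h].
  by rewrite big1 // => i _; rewrite indicE mem_set.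
have [i hi] : exists i, ~ A i (y i).
  by apply/existsNP => h'; move/negP: h; apply; apply/mem_set.
by rewrite (bigD1 i) //= indicE memNset // mul0r.
Qed.

Let product_measure_sum : exists (N : nat) (c : I -> 'I_N -> R)
    (y : forall i, 'I_N -> Y i),
  (forall i A, m i A = \sum_k c i k * \1_A (y i k)) /\
  (forall A, product_measure m A =
     \sum_(f : {ffun I -> 'I_N}) (\prod_i c i (f i)) * \1_A (fun i => y i (f i))).
Proof.
have [s sE] : exists s : forall i, seq (R * Y i), forall i A,
    m i A = \sum_(c <- s i) c.1 * \1_A c.2.
  exists (fun i => projT1 (cid (mD i))) => i; exact: (projT2 (cid (mD i))).
pose N := \max_i size (s i).
pose c i (k : 'I_N) := (nth (0, y0 i) (s i) k).1.
pose y i (k : 'I_N) := (nth (0, y0 i) (s i) k).2.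
have mE i A : m i A = \sum_k c i k * \1_A (y i k).
  rewrite sE (big_nth (0, y0 i)) big_mkord.
  have sN : (size (s i) <= N)%N by exact: (leq_bigmax i).
  rewrite (big_ord_widen N (fun k => (nth (0, y0 i) (s i) k).1 *
    \1_A (nth (0, y0 i) (s i) k).2)) // big_mkcond /=.
  apply: eq_bigr => k _; rewrite /c /y; case: ltnP => // ?.
  by rewrite nth_default // mul0r.
exists N, c, y; split=> // A.
pose w (f : {ffun I -> 'I_N}) : forall i, Y i := fun i => y i (f i).
pose S := [seq w f | f : {ffun I -> 'I_N}].
have pE x : \prod_i m i [set x i] =
    \sum_(f : {ffun I -> 'I_N}) (\prod_i c i (f i)) * (x == w f)%:R.
  under eq_bigr do rewrite mE.
  rewrite bigA_distr_bigA; apply: eq_bigr => f _.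
  rewrite big_split /=; congr (_ * _).
  rewrite (prod_indic (w f) (fun i => [set x i])) indicE; congr (nat_of_bool _)%:R.
  apply/idP/eqP => [/set_mem /= h|->]; last by apply/mem_set.
  by apply: functional_extensionality_dep => i; rewrite h.
have SE f : w f \in undup S by rewrite mem_undup; apply/mapP; exists f; rewrite ?mem_enum.
have -> : product_measure m A = \sum_(x <- undup S | x \in A) \prod_i m i [set x i].
  rewrite (bigfs _ (undup_uniq S)); first by rewrite set_mem_set.
  move=> x _ xS; rewrite pE big1 // => f _.
  by case: eqVneq xS => [->|_ _]; rewrite ?SE // mulr0.
under eq_bigr do rewrite pE.
rewrite exchange_big /=; apply: eq_bigr => f _; rewrite -mulr_sumr; congr (_ * _).
rewrite indicE big_mkcond (bigD1_seq (w f)) ?undup_uniq ?SE //= eqxx big1 ?addr0.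
  by case: ifP.
by move=> x /negPf ->; rewrite if_same.
Qed.

Lemma product_measure_discrete : discrete_measure (product_measure m).
Proof.
have [N [c [y [_ pE]]]] := product_measure_sum.
exists [seq (\prod_i c i (f i), fun i => y i (f i)) | f : {ffun I -> 'I_N}] => A.
by rewrite pE big_image.
Qed.

Lemma product_measure_rectangle (A : forall i, set (Y i)) :
  product_measure m [set x | forall i, A i (x i)] = \prod_i m i (A i).
Proof.
have [N [c [y [mE ->]]]] := product_measure_sum.
under [RHS]eq_bigr do rewrite mE.
rewrite bigA_distr_bigA; apply: eq_bigr => f _.
by rewrite big_split /= -prod_indic.
Qed.

End ProductMeasureTheory.

Section Interaction.
Variables (R : realType) (n : nat) (X : 'I_n -> choiceType).

Definition subproduct (F : {set 'I_n}) : choiceType :=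
  (forall i : {i : 'I_n | i \in F}, X (val i)) : choiceType.

Definition restrict_to (F : {set 'I_n}) (x : forall i, X i) : subproduct F :=
  fun i => x (val i).

Definition marginal (P : set (forall i, X i) -> R) (F : {set 'I_n}) :
    set (subproduct F) -> R :=
  fun B => P (@restrict_to F @^-1` B).

Definition split_blocks (p : {set {set 'I_n}}) (x : forall i, X i) :
    forall F : {F : {set 'I_n} | F \in p}, subproduct (val F) :=
  fun F => @restrict_to (val F) x.

Lemma split_blocks_bij (p : {set {set 'I_n}}) :
  p \in Partitions n -> bijective (@split_blocks p).
Proof.
rewrite inE => /and3P[/eqP cov tr _].
have bp i : finset.pblock p i \in p by apply: finset.pblock_mem; rewrite cov finset.in_setT.
have ib i : i \in finset.pblock p i by rewrite finset.mem_pblock cov finset.in_setT.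
exists (fun (y : forall F : {F : {set 'I_n} | F \in p}, subproduct (val F))
  (i : 'I_n) => y (exist _ (finset.pblock p i) (bp i)) (exist _ i (ib i))).
  by move=> x; apply: functional_extensionality_dep.
move=> y; apply: functional_extensionality_dep => -[B Bp].
apply: functional_extensionality_dep => -[i iB].
rewrite /split_blocks /restrict_to /=.
have e := finset.def_pblock tr Bp iB; case: _ / e in Bp iB *.
by rewrite (bool_irrelevance (bp i) Bp) (bool_irrelevance (ib i) iB).
Qed.

(* The product over the blocks F of p of the marginals P_F lives on
   \prod_(F in p) \prod_(i in F) X i; when p is a partition, [split_blocks p]
   is a bijection from \prod_i X i onto that space, along which it is transported. *)
Definition partition_measure (P : set (forall i, X i) -> R)
    (p : {set {set 'I_n}}) : set (forall i, X i) -> R :=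
  fun A => product_measure
    (fun F : {F : {set 'I_n} | F \in p} => @marginal P (val F))
    (@split_blocks p @` A).

Definition interaction (T : {set {set {set 'I_n}}})
    (P : set (forall i, X i) -> R) : set (forall i, X i) -> R :=
  fun A => \sum_(p in T)
    (mobius T p (top_part n))%:~R * partition_measure P p A.

End Interaction.

(* Main.v *)
Require Import Defs.
From mathcomp Require Import all_boot all_order all_algebra all_fingroup.
From mathcomp Require Import all_classical all_reals numfun.

Set Implicit Arguments.
Unset Strict Implicit.
Unset Printing Implicit Defensive.

Import Order.TTheory GRing.Theory Num.Theory.

Local Open Scope classical_set_scope.
Local Open Scope ring_scope.

(** P is a small perturbation of a product probability.  Each [mu i] is
    dominated by a probability: [|mu i| <= K i * q i], so that, with
    [Q = product_measure q] and [M = (\prod_i K i)^-1], the measure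
    [P = Q + M * (-1) ^+ n * product_measure mu] is nonnegative.

    Let [k] be the order of the lattice.  A block F of a partition p of T other
    than the top one has fewer than k elements, so it misses an index i at
    which [mu i] has total mass zero; hence the F-marginal of
    [product_measure mu] vanishes and P has the same F-marginal as Q.  As Q is
    a product, [partition_measure P p] is Q itself.  The top partition
    contributes P with coefficient 1, so

      [interaction T P = (\sum_(p in T) mobius T p top) Q
                         + M * (-1) ^+ n * product_measure mu],

    and the sum vanishes since the bottom and top partitions differ.

    Two facts carry the computation.  The Moebius function is defined by a
    recursion that sums over its second argument, while the sum above runs over
    the first one; [sum_mobius_above] passes from one to the other.  And a
    discrete measure is determined by its values on points, so all identities
    between measures on the product space reduce, through [partition_measureE]
    and [product_measure_cylinder], to identities between finite products. *)

Section MobiusDual.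
Variables (n : nat) (T : {set {set {set 'I_n}}}).
Hypothesis TP : T \subset Partitions n.
Implicit Types x y z : {set {set 'I_n}}.

(** The recursion that defines the Moebius function, as a matrix identity: the
    matrix of [mobius] is a left inverse of the incidence matrix of [refines]. *)
Lemma sum_mobius_below x y : x \in T -> y \in T ->
  \sum_(z in T) mobius T x z * (refines z y)%:R = (x == y)%:R.
Proof.
move=> xT yT.
have -> : \sum_(z in T) mobius T x z * (refines z y)%:R
    = \sum_(z in T | refines x z && refines z y) mobius T x z.
  rewrite [RHS]big_mkcondr; apply: eq_bigr => z zT.
  case: (boolP (refines z y)) => zy; rewrite ?andbF ?andbT ?mulr0 // mulr1.
  by case: ifP => // /negbT xz; rewrite mobius_out // (negPf xz) !andbF.
have [->|nxy] := eqVneq x y.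
  rewrite (big_pred1 y) => [|z /=]; first exact: mobiusxx.
  apply/and3P/eqP => [[zT yz zy]|->]; last by rewrite yT refines_refl.
  by apply: refines_anti zy yz; apply: (fintype.subsetP TP).
have [xy|xy] := boolP (refines x y); last first.
  rewrite big_pred0 // => z; apply: contraNF xy => /and3P[_].
  exact: refines_trans.
rewrite (bigD1 y) ?yT ?xy ?refines_refl //= (mobius_lt TP) //; last first.
  by rewrite /srefines xy.
apply/eqP; rewrite addrC subr_eq0; apply/eqP; apply: eq_bigl => z.
by rewrite /srefines !andbA.
Qed.

(** A left inverse of a square matrix over a commutative ring is also a right
    inverse. *)
Lemma sum_mobius_above x y : x \in T -> y \in T ->
  \sum_(z in T) (refines x z)%:R * mobius T z y = (x == y)%:R.
Proof.
move=> xT yT.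
pose e (i : 'I_#|T|) := enum_val i.
pose M : 'M[int]_#|T| := \matrix_(i, j) mobius T (e i) (e j).
pose Z : 'M[int]_#|T| := \matrix_(i, j) (refines (e i) (e j))%:R.
have /mulmx1C/matrixP/(_ (enum_rank_in xT x) (enum_rank_in yT y)) : M *m Z = 1%:M.
  apply/matrixP => i j; rewrite !mxE -(inj_eq enum_val_inj).
  rewrite -(sum_mobius_below (enum_valP i) (enum_valP j)) [RHS]big_enum_val.
  by apply: eq_bigr => l _; rewrite !mxE.
rewrite !mxE -(inj_eq enum_val_inj) !enum_rankK_in // => <-.
rewrite big_enum_val; apply: eq_bigr => l _.
by rewrite !mxE /e !enum_rankK_in.
Qed.

End MobiusDual.

Lemma bottom_part_refines (n : nat) (p : {set {set 'I_n}}) :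
  p \in Partitions n -> refines (bottom_part n) p.
Proof.
rewrite inE => /and3P[/eqP cov _ _]; apply/refinesP => _ /imsetP[i _ ->].
have ip : i \in finset.cover p by rewrite cov finset.in_setT.
by exists (finset.pblock p i); rewrite ?finset.pblock_mem // finset.sub1set finset.mem_pblock.
Qed.

Lemma bottom_part_neq_top (n : nat) : (2 <= n)%N -> bottom_part n != top_part n.
Proof.
move=> hn; apply/eqP => e.
have : [set Ordinal (ltnW hn)]%SET \in top_part n by rewrite -e finset.imset_f.
move=> /set1P /(congr1 (fun A : {set 'I_n} => #|A|)).
by rewrite cards1 cardsT card_ord => e1; rewrite -e1 in hn.
Qed.

Lemma sum_mobius_top (n : nat) (T : {set {set {set 'I_n}}}) : (2 <= n)%N ->
  lower_set T -> \sum_(p in T) mobius T p (top_part n) = 0.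
Proof.
move=> hn [TP bT tT _]; have := sum_mobius_above TP bT tT.
rewrite (negPf (bottom_part_neq_top hn)); apply: etrans; apply: eq_bigr => p pT.
by rewrite bottom_part_refines ?mul1r // (fintype.subsetP TP).
Qed.

Lemma card_block_lt_order (n : nat) (T : {set {set {set 'I_n}}})
    (p : {set {set 'I_n}}) (F : {set 'I_n}) :
  p \in T -> p != top_part n -> F \in p -> (#|F| < lattice_order T)%N.
Proof.
move=> pT pt Fp; rewrite ltnS.
apply: leq_trans (leq_bigmax_cond (F := fun B : {set 'I_n} => #|B|) _ Fp) _.
by apply: (leq_bigmax_cond
  (F := fun p : {set {set 'I_n}} => \max_(B in p) #|B|)); rewrite pT.
Qed.

Section DiscreteMeasures.
Variables (R : realType) (Y : choiceType).
Implicit Types m : set Y -> R.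

Lemma discrete_measure_fsbig m : discrete_measure m ->
  forall A, m A = \sum_(x \in A) m [set x].
Proof.
move=> [s sE] A; pose r := undup [seq c.2 | c <- s].
have E x : m [set x] = \sum_(c <- s) c.1 * (x == c.2)%:R.
  rewrite sE; apply: eq_bigr => c _; rewrite indicE; congr (_ * (nat_of_bool _)%:R).
  by apply/idP/eqP => [/set_mem /= ->|->]; last exact/mem_set.
have -> : \sum_(x \in A) m [set x] = \sum_(x <- r | x \in A) m [set x].
  rewrite (bigfs _ (undup_uniq _)) ?set_mem_set // => x _; rewrite mem_undup => xr.
  rewrite E big1_seq // => c /andP[_ cs].
  by case: eqVneq xr => [->|_ _]; rewrite ?map_f ?mulr0.
under [RHS]eq_bigr do rewrite E.
rewrite exchange_big sE /=; apply: eq_big_seq => c cs; rewrite -mulr_sumr.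
congr (_ * _).
rewrite indicE big_mkcond (bigD1_seq c.2) ?undup_uniq ?mem_undup ?map_f //= eqxx.
by rewrite big1 ?addr0 => [|x /negPf ->]; [case: ifP | rewrite if_same].
Qed.

Lemma discrete_measure_add_scale m m' (a : R) :
  discrete_measure m -> discrete_measure m' ->
  discrete_measure (fun A => m A + a * m' A).
Proof.
move=> [s sE] [s' sE']; exists (s ++ [seq (a * c.1, c.2) | c <- s']) => A.
rewrite big_cat big_map sE sE' mulr_sumr; congr (_ + _).
by apply: eq_bigr => c _; rewrite mulrA.
Qed.

(** The probability [q] is the normalised total variation of a decomposition of
    [m] into Dirac measures; the extra mass at [y0] makes the normalising
    constant positive even if [m] is zero. *)
Lemma discrete_measure_dominated (y0 : Y) m : discrete_measure m ->
  exists2 K : R, 0 < K & exists2 q : set Y -> R, discrete_probability q &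
    forall A, `|m A| <= K * q A.
Proof.
move=> [s sE]; pose K : R := 1 + \sum_(c <- s) `|c.1|.
have K0 : 0 < K by rewrite ltr_pwDl ?ltr01 ?sumr_ge0.
pose q A : R := K^-1 * (\1_A y0 + \sum_(c <- s) `|c.1| * \1_A c.2).
exists K => //; exists q; last first.
  move=> A; rewrite /q mulrA divff ?gt_eqF // mul1r sE.
  apply: le_trans (ler_norm_sum _ _ _) _; rewrite ler_wpDl ?indicE ?ler0n //.
  by apply: ler_sum => c _; rewrite normrM [X in _ * X]ger0_norm // indicE ler0n.
split.
- exists ((K^-1, y0) :: [seq (K^-1 * `|c.1|, c.2) | c <- s]) => A.
  rewrite big_cons big_map /q mulrDr mulr_sumr; congr (_ + _).
  by apply: eq_bigr => c _; rewrite mulrA.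
- move=> A; rewrite mulr_ge0 ?invr_ge0 ?(ltW K0) //.
  rewrite addr_ge0 ?sumr_ge0 ?indicE ?ler0n // => c _.
  by apply: mulr_ge0; rewrite ?indicE ?ler0n.
- rewrite /q indicT; under eq_bigr do rewrite mulr1.
  by rewrite mulVf // gt_eqF.
Qed.

End DiscreteMeasures.

Section Products.
Variables (R : realType) (n : nat) (X : 'I_n -> choiceType).
Variable (x0 : forall i, X i).
Implicit Types (P : set (forall i, X i) -> R) (F : {set 'I_n}) (x : forall i, X i).

Definition cylinder F x : set (forall i, X i) :=
  [set z | forall i, i \in F -> z i = x i].

(** Transporting the product of the marginals back along [split_blocks], the mass
    that the F-marginal gives to the point [restrict_to F x] is the mass that P
    gives to the cylinder over that point. *)
Lemma partition_measureE P (p : {set {set 'I_n}}) (A : set (forall i, X i)) :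
  p \in Partitions n ->
  partition_measure P p A = \sum_(x \in A) \prod_(F in p) P (cylinder F x).
Proof.
move=> pP; rewrite /partition_measure /product_measure fsbig_image; last first.
  by move=> x y _ _; apply/bij_inj/split_blocks_bij.
apply: eq_fsbigr => x _; rewrite [RHS]big_sub; apply: eq_bigr => -[F Fp] _.
rewrite /marginal; congr P; apply/seteqP; split=> z /=.
  by move=> e i iF; have := congr1 (fun f => f (exist _ i iF)) e.
by move=> h; apply: functional_extensionality_dep => -[i iF]; apply: h.
Qed.

Lemma cylinder_setT x : cylinder [set: 'I_n]%SET x = [set x].
Proof.
apply/seteqP; split=> z; last by move=> ->.
by move=> h; apply: functional_extensionality_dep => i; rewrite h ?inE.
Qed.

Lemma product_measure_cylinder (m : forall i, set (X i) -> R) F x :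
  (forall i, discrete_measure (m i)) ->
  product_measure m (cylinder F x) =
    (\prod_(i in F) m i [set x i]) * \prod_(i | i \notin F) m i setT.
Proof.
move=> mD; pose B i : set (X i) := if i \in F then [set x i] else setT.
have -> : cylinder F x = [set z | forall i, B i (z i)].
  apply/seteqP; split=> z /= h i; first by rewrite /B; case: ifP => // /h ->.
  by move=> iF; have := h i; rewrite /B iF.
rewrite (product_measure_rectangle x0 mD) (bigID (mem F)) /=.
by congr (_ * _); apply: eq_bigr => i; rewrite /B; [move=> -> | move=> /negPf ->].
Qed.

Lemma product_measure_point (m : forall i, set (X i) -> R) x :
  (forall i, discrete_measure (m i)) ->
  product_measure m [set x] = \prod_i m i [set x i].
Proof.
move=> mD; rewrite -cylinder_setT product_measure_cylinder //.
rewrite [X in _ * X]big_pred0 ?mulr1 => [|i]; last by rewrite inE.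
by apply: eq_bigl => i; rewrite inE.
Qed.

(** The order bounds every block of every partition below the top one, so it does
    not matter at which indices the [mu i] have zero mass, only how many there
    are. *)
Lemma interaction_onto_product (T : {set {set {set 'I_n}}})
    (mu : forall i, set (X i) -> R) :
  (2 <= n)%N -> lower_set T -> (forall i, discrete_measure (mu i)) ->
  (lattice_order T <= #|[pred i | mu i setT == 0%R]|)%N ->
  exists (M : R) P, [/\ 0 < M, discrete_probability P
    & forall A, interaction T P A = M * (-1) ^+ n * product_measure mu A].
Proof.
move=> hn lowT hmu hzero.
have /fin_all_exists2[K K0 /fin_all_exists2[q qP qK]] :=
  fun i => discrete_measure_dominated (x0 i) (hmu i).
have [TP _ topT _] := lowT.
have qD i : discrete_measure (q i) by have [] := qP i.
pose M : R := (\prod_i K i)^-1.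
have K_gt0 : 0 < \prod_i K i by apply: prodr_gt0.
have M0 : 0 < M by rewrite invr_gt0.
pose a := M * (-1) ^+ n.
pose P A := product_measure q A + a * product_measure mu A.
have PD : discrete_measure P.
  by apply: discrete_measure_add_scale; apply: product_measure_discrete.
(* A small F misses an index of zero mass, which kills the perturbation. *)
have cylE F x : (#|F| < lattice_order T)%N ->
    P (cylinder F x) = \prod_(i in F) q i [set x i].
  move=> Fk; rewrite /P !product_measure_cylinder //.
  have [i iF mui] : exists2 i, i \notin F & mu i setT = 0.
    have /fintype.subsetPn[i + iF] : ~~ ([pred i | mu i setT == 0] \subset F).
      by apply: contraL Fk => /subset_leq_card h; rewrite -leqNgt (leq_trans hzero).
    by rewrite inE => /eqP; exists i.
  rewrite [X in _ * X]big1 => [|j _]; last by have [] := qP j.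
  by rewrite [X in a * (_ * X)](bigD1 i) //= mui mul0r !mulr0 addr0 mulr1.
have part_lt p A : p \in T -> p != top_part n ->
    partition_measure P p A = product_measure q A.
  move=> pT pt; have pP := fintype.subsetP TP _ pT.
  rewrite partition_measureE //; apply: eq_fsbigr => x _.
  have part_p : finset.partition p [set: 'I_n]%SET by move: pP; rewrite inE.
  have -> : \prod_i q i [set x i] = \prod_(i in [set: 'I_n]%SET) q i [set x i].
    by apply: eq_bigl => i; rewrite inE.
  rewrite (set_partition_big _ part_p); apply: eq_bigr => F Fp.
  by rewrite cylE // (card_block_lt_order pT).
have part_top A : partition_measure P (top_part n) A = P A.
  rewrite partition_measureE ?(fintype.subsetP TP) // [RHS]discrete_measure_fsbig //.
  by apply: eq_fsbigr => x _; rewrite big_set1 cylinder_setT.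
exists M, P; split => //.
  split=> // [A|]; last first.
    (* The whole space is the cylinder over the empty set of coordinates. *)
    have -> : [set: forall i, X i] = cylinder finset.set0 x0.
      by apply/seteqP; split=> // z _ i; rewrite inE.
    by rewrite cylE ?cards0 // big_set0.
  rewrite discrete_measure_fsbig //; apply: fsumr_ge0 => x _.
  rewrite /P !product_measure_point //.
  suff /ler_normlP[h _] : `|a * \prod_i mu i [set x i]| <= \prod_i q i [set x i].
    by rewrite -lerBlDr sub0r.
  rewrite !normrM normrX normrN1 expr1n mulr1 gtr0_norm // normr_prod.
  rewrite ler_pdivrMl // -big_split; apply: ler_prod => i _.
  by rewrite normr_ge0 qK.
move=> A; rewrite -/a /interaction (bigD1 (top_part n)) //= part_top mobiusxx // mul1r.
rewrite (eq_bigr (fun p => (mobius T p (top_part n))%:~R * product_measure q A)); last first.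
  by move=> p /andP[pT pt]; rewrite part_lt.
have /(congr1 (fun z : int => z%:~R : R)) := sum_mobius_top hn lowT.
rewrite (bigD1 (top_part n)) //= mobiusxx // rmorphD /= rmorph_sum /= => e.
by rewrite -mulr_suml /P addrAC -[X in X + _ + _]mul1r -mulrDl e mul0r add0r.
Qed.

End Products.

Theorem theorem3p10 (R : realType) (n : nat) (hn : (2 <= n)%N)
    (X : 'I_n -> pointedType)
    (T : {set {set {set 'I_n}}}) (k : nat)
    (hT : symmetric_partition_lattice T) (hk : lattice_order T = k)
    (mu : forall i : 'I_n, set (X i) -> R)
    (hmu : forall i : 'I_n, discrete_measure (mu i))
    (hzero : (k <= #|[pred i : 'I_n | mu i setT == 0%R]|)%N) :
  exists (M : R) (P : set (forall i : 'I_n, X i) -> R),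
    [/\ 0 < M,
        discrete_probability P
      & forall A : set (forall i : 'I_n, X i),
          interaction T P A = M * (-1) ^+ n * product_measure mu A].
Proof.
have [lowT _] := hT; rewrite -hk in hzero.
exact: (interaction_onto_product (fun i => point) hn lowT hmu hzero).
Qed.
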